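(* Let $\mathscr{A}$ be a $C^*$-algebra with unit $e$ and let $a\in\mathscr{A}$. For any $\alpha,\beta\in\mathbb{C}\setminus\{0\}$, $$v^3(a)\leq\frac{\max\{1,|\alpha-1|\}}{2|\alpha|}\left\|\,|a^*|^2+|a|^2\right\|\,\|a\|+\frac{\max\{1,|\beta-1|\}}{|\alpha\beta|}\|a^2\|\,\|a\|+\frac{1}{|\alpha\beta|}v(a^3).$$
   Context: $\mathcal{S}(\mathscr{A})$ is the state space of $\mathscr{A}$, i.e. the set of positive linear functionals $\varphi$ on $\mathscr{A}$ with $\varphi(e)=1$. The numerical radius of $a\in\mathscr{A}$ is $v(a)=\sup\{|\varphi(a)|:\varphi\in\mathcal{S}(\mathscr{A})\}$, and $v^k(a)$ means $(v(a))^k$. $\|\cdot\|$ is the $C^*$-norm, $|a|^2=a^*a$ and $|a^*|^2=aa^*$. *)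

(* Defs.v *)
From HB Require Import structures.
From mathcomp Require Import all_boot all_order all_algebra.
From mathcomp Require Import complex.
From mathcomp Require Import all_classical all_reals all_analysis.

Set Implicit Arguments.
Unset Strict Implicit.
Unset Printing Implicit Defensive.

Import Order.TTheory GRing.Theory Num.Theory.
Import numFieldNormedType.Exports.

Local Open Scope classical_set_scope.
Local Open Scope ring_scope.
Local Open Scope complex_scope.

(* Nonzero unital C*-algebras over the complex numbers [R[i]]. The norm
   [`|x|] is the one of the complete normed module; it takes its values in
   [R[i]], where they are nonnegative reals. The product is given by the fields
   [cstar_mul] and [cstar_one] because Hierarchy Builder admits no structure
   joining [GRing.PzSemiRing] with a normed module below [Num.NumDomain]; the
   instances declared afterwards give back [x * y], [1], [x ^+ n] and
   [{scalar A}] of [GRing.Algebra]. *)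
HB.mixin Record CompleteNormedModule_isCStarAlgebra (R : realType) A
    of CompleteNormedModule R[i] A := {
  cstar_mul : A -> A -> A ;
  cstar_one : A ;
  cstar_mulA : associative cstar_mul ;
  cstar_mul1l : left_id cstar_one cstar_mul ;
  cstar_mul1r : right_id cstar_one cstar_mul ;
  cstar_mulDl : left_distributive cstar_mul +%R ;
  cstar_mulDr : right_distributive cstar_mul +%R ;
  cstar_one_neq0 : cstar_one != 0 ;
  cstar_scaleAl : forall (k : R[i]) (x y : A),
    k *: cstar_mul x y = cstar_mul (k *: x) y ;
  cstar_scaleAr : forall (k : R[i]) (x y : A),
    k *: cstar_mul x y = cstar_mul x (k *: y) ;
  cstar_normM : forall x y : A, `|cstar_mul x y| <= `|x| * `|y| ;
  star : A -> A ;
  starK : involutive star ;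
  starD : {morph star : x y / x + y} ;
  starZ : forall (k : R[i]) (x : A), star (k *: x) = conjc k *: star x ;
  star_mul : forall x y : A,
    star (cstar_mul x y) = cstar_mul (star y) (star x) ;
  cstar_normE : forall x : A, `|cstar_mul (star x) x| = `|x| ^+ 2
}.

#[short(type="cstarAlgType")]
HB.structure Definition CStarAlgebra (R : realType) :=
  {A of CompleteNormedModule R[i] A & CompleteNormedModule_isCStarAlgebra R A}.

#[non_forgetful_inheritance]
HB.instance Definition _ (R : realType) (A : cstarAlgType R) :=
  GRing.Zmodule_isNzRing.Build A cstar_mulA cstar_mul1l cstar_mul1r
    cstar_mulDl cstar_mulDr cstar_one_neq0.

#[non_forgetful_inheritance]
HB.instance Definition _ (R : realType) (A : cstarAlgType R) :=
  GRing.LSemiModule_isLSemiAlgebra.Build R[i] A cstar_scaleAl.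

#[non_forgetful_inheritance]
HB.instance Definition _ (R : realType) (A : cstarAlgType R) :=
  GRing.LSemiAlgebra_isSemiAlgebra.Build R[i] A cstar_scaleAr.

(* Positive elements are those of the form [star x * x]; in the order of
   [R[i]], [0 <= z] says that [z] is real and nonnegative. *)
Definition positive_functional (R : realType) (A : cstarAlgType R)
    (phi : {scalar A}) : Prop :=
  forall x : A, 0 <= phi (star x * x).

Definition state_space (R : realType) (A : cstarAlgType R) : set {scalar A} :=
  [set phi | positive_functional phi /\ phi 1 = 1].

Arguments state_space {R} A _ : rename.

(* [Normc.normc z : R] is the modulus of [z], with [`|z| = (normc z)%:C]. The
   set is nonempty and bounded above by the norm of [a], so that [sup], taken
   in [R], is a genuine supremum; it is embedded in [R[i]], where the norms of
   elements of [A] live. *)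
Definition numerical_radius (R : realType) (A : cstarAlgType R) (a : A) : R[i] :=
  (sup [set ComplexField.Normc.normc (phi a) | phi in state_space A])%:C.

(* Main.v *)
Require Import Defs.
From HB Require Import structures.
From mathcomp Require Import all_boot all_order all_algebra.
From mathcomp Require Import complex.
From mathcomp Require Import all_classical all_reals all_analysis.
From mathcomp Require Import ring.

Set Implicit Arguments.
Unset Strict Implicit.
Unset Printing Implicit Defensive.

Import Order.TTheory GRing.Theory Num.Theory.
Import numFieldNormedType.Exports.

Local Open Scope ring_scope.

(** The bound is proved for one state phi at a time, and then the supremum over
    the states is taken. A state makes the algebra a pre-Hilbert space, with
    <x, y> = phi (star y * x), in which the unit 1 is a unit vector and
    phi x = <x, 1>. In such a space the operator that sends x to
    alpha <x, 1> 1 - x multiplies the line through 1 by alpha - 1 and its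
    orthogonal complement by -1, so that its norm is at most
    M alpha = max (1, |alpha - 1|). Cauchy-Schwarz then gives an inequality of
    Buzano type ([state_buzano]):

      |alpha| |<x, 1> <1, y>| <= M alpha ||x|| ||y|| + |<x, y>|.

    With y = star a it bounds the product of phi x and phi a, since
    <1, star a> = phi a, by a term involving phi (a * x). Used with x = a it
    bounds |phi a|^2 by a term in phi (a^2); multiplying by |phi a| brings in
    the product of phi (a^2) and phi a, to which the inequality applies again,
    now with x = a^2 and the parameter beta, and yields phi (a^3)
    ([state_cube_le]). What remains is to bound the seminorms that the two uses
    leave behind: sqrt (phi (star a * a)) sqrt (phi (a * star a)) is at most
    half the norm of a * star a + star a * a by the arithmetic-geometric mean
    inequality ([state_seminorm_AGM]), and every seminorm is at most the
    C*-norm ([state_seminorm_le]).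

    These last bounds rest on phi h <= `|h| for a self-adjoint h
    ([state_le_norm]). States are only assumed linear and positive, so this is
    where completeness enters: when `|h| < t, the element t - h is the square of
    a self-adjoint element ([sqrt_one_sub_exists]), hence phi (t - h) >= 0. *)

(** * Contractions over the complex scalars *)

Lemma complex_geometric_lt (R : realType) (K q e : R[i]) :
  0 <= K -> 0 <= q -> q < 1 -> 0 < e -> exists n, K * q ^+ n < e.
Proof.
move=> K0 q0 q1 e0.
have KE : K = (complex.Re K)%:C%C by rewrite RRe_real// ger0_real.
have qE : q = (complex.Re q)%:C%C by rewrite RRe_real// ger0_real.
have eE : e = (complex.Re e)%:C%C by rewrite RRe_real// gtr0_real.
rewrite KE qE eE in K0 q0 q1 e0 *.
move: (complex.Re K) (complex.Re q) (complex.Re e) K0 q0 q1 e0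
  => {KE qE eE}k p d.
rewrite !(ler0c, ltcR) => k0 p0 p1 d0.
have /cvgrPdist_lt/(_ _ d0)[n _ /(_ n (leqnn n))/=] :
    (geometric k p x @[x --> \oo] --> 0)%classic.
  by apply: cvg_geometric; rewrite ger0_norm.
rewrite sub0r normrN ger0_norm ?mulr_ge0 ?exprn_ge0// => kpd.
by exists n; rewrite -rmorphXn -rmorphM ltcR.
Qed.

Lemma le_geometric_le0 (R : realType) (K q x : R[i]) :
  0 <= K -> 0 <= q -> q < 1 -> (forall n, x <= K * q ^+ n) -> x <= 0.
Proof.
move=> K0 q0 q1 xle; apply/ler_addgt0Pr => e e0; rewrite add0r.
by have [n /ltW] := complex_geometric_lt K0 q0 q1 e0; exact: le_trans.
Qed.

(** The iterates satisfy `|f^n x0 - f^(n+m) x0| <= q^n `|x0 - f^m x0|, and the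
    last factor is at most D because the whole orbit stays in U: they form a
    Cauchy sequence. The set U need not be closed, so the limit may fall outside
    U; the rate of convergence is what later identifies it. *)
Lemma contraction_cvg_dist (R : realType) (V : completeNormedModType R[i])
    (U : set V) (f : V -> V) (D q : R[i]) (x0 : V) :
  0 <= q -> q < 1 ->
  (forall x, U x -> U (f x)) -> (forall x, U x -> `|x0 - x| <= D) ->
  (forall x y, U x -> U y -> `|f x - f y| <= q * `|x - y|) -> U x0 ->
  exists l, forall n, `|l - iter n f x0| <= D * q ^+ n.
Proof.
move=> q0 q1 fU Ule fq Ux0; pose y n := iter n f x0.
have Uy n : U (y n) by elim: n => //= n; exact: fU.
have yD n m : `|y n - y (n + m)%N| <= D * q ^+ n.
  elim: n => [|n IH]; first by rewrite expr0 mulr1 add0n; exact: Ule.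
  rewrite addSn /= (le_trans (fq _ _ (Uy _) (Uy _)))//.
  by rewrite exprS mulrCA ler_wpM2l.
have D0 : 0 <= D := le_trans (normr_ge0 _) (Ule _ Ux0).
have : cvg (y n @[n --> \oo])%classic.
  apply: cauchy_cvg; apply: cauchy_exP => e e0.
  have [N Ne] := complex_geometric_lt D0 q0 q1 e0.
  exists (y N); exists N => // n /= Nn.
  by rewrite -ball_normE /= (le_lt_trans _ Ne)// -(subnKC Nn).
move=> /cvg_ex[l yl]; exists l => n.
apply/ler_addgt0Pl => e e0.
move/cvgrPdist_lt: yl => /(_ _ e0)[N _ /(_ (n + N)%N (leq_addl _ _))/= lN].
rewrite (le_trans (ler_distD (y (n + N)%N) _ _))// lerD ?(ltW lN) 1?distrC//.
exact: yD.
Qed.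

(** * The involution *)

(* The structure states these laws with its own product and with conjc; here
   they are put in terms of the ring product and of the conjugation of numeric
   closed fields, which is what rewriting recognizes. *)
Lemma starM (R : realType) (A : cstarAlgType R) (x y : A) :
  star (x * y) = star y * star x.
Proof. exact: star_mul. Qed.

Lemma cstar_ler_normM (R : realType) (A : cstarAlgType R) (x y : A) :
  `|x * y| <= `|x| * `|y|.
Proof. exact: cstar_normM. Qed.

Lemma starZ_conj (R : realType) (A : cstarAlgType R) (k : R[i]) (x : A) :
  star (k *: x) = k^* *: star x.
Proof. exact: starZ. Qed.

Lemma norm_starM (R : realType) (A : cstarAlgType R) (x : A) :
  `|star x * x| = `|x| ^+ 2.
Proof. exact: cstar_normE. Qed.

Lemma star1 (R : realType) (A : cstarAlgType R) : star 1 = 1 :> A.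
Proof. by rewrite -[LHS]mulr1 -{2}[1]starK -starM mulr1 starK. Qed.

Lemma star0 (R : realType) (A : cstarAlgType R) : star 0 = 0 :> A.
Proof. by apply: (addrI (star 0)); rewrite -starD !addr0. Qed.

Lemma starN (R : realType) (A : cstarAlgType R) (x : A) : star (- x) = - star x.
Proof. by apply: (addrI (star x)); rewrite -starD !subrr star0. Qed.

Lemma starB (R : realType) (A : cstarAlgType R) (x y : A) :
  star (x - y) = star x - star y.
Proof. by rewrite starD starN. Qed.

Lemma norm_star (R : realType) (A : cstarAlgType R) (x : A) : `|star x| = `|x|.
Proof.
have le_star (y : A) : `|y| <= `|star y|.
  have [->|y0] := eqVneq y 0; first by rewrite normr0.
  have yp : 0 < `|y| by rewrite normr_gt0.
  by rewrite -(ler_pM2r yp) -expr2 -norm_starM cstar_ler_normM.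
by apply/le_anti; rewrite le_star andbT -{2}(starK x) le_star.
Qed.

(** * Square roots in a C*-algebra *)

Lemma norm_half (R : realType) (A : cstarAlgType R) (x : A) :
  `|(2^-1 : R[i]) *: x| = 2^-1 * `|x|.
Proof. by rewrite normrZ ger0_norm ?invr_ge0. Qed.

(** The square root of 1 - h is 1 - l for a solution l of l = (h + l^2) / 2.
    The right-hand side preserves the self-adjoint elements of the ball of
    radius r = `|h| < 1 and is r-Lipschitz there, because
    x^2 - y^2 = x (x - y) + (x - y) y holds without commutation. *)
Lemma sqrt_one_sub_exists (R : realType) (A : cstarAlgType R) (h : A) :
  star h = h -> `|h| < 1 -> exists2 s, star s = s & s * s = 1 - h.
Proof.
move=> hh; set r := `|h| => r1.
have r0 : 0 <= r by exact: normr_ge0.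
pose f (y : A) : A := (2^-1 : R[i]) *: (h + y * y).
pose U : set A := [set y | star y = y /\ `|y| <= r]%classic.
have fU x : U x -> U (f x).
  move=> [sx xr]; split.
    rewrite starZ starD starM sx hh; congr (_ *: _).
    by rewrite conjc_inv conjc_nat.
  rewrite norm_half (le_trans (ler_wpM2l _ (ler_normD _ _))) ?invr_ge0//.
  rewrite ler_pdivrMl ?ltr0n// mulr_natl mulr2n lerD//.
  rewrite (le_trans (cstar_ler_normM _ _))//.
  by rewrite -[leRHS]mulr1 ler_pM// (le_trans xr (ltW r1)).
have fdist x y : `|f x - f y| <= 2^-1 * ((`|x| + `|y|) * `|x - y|).
  rewrite -scalerBr norm_half ler_wpM2l ?invr_ge0//.
  have -> : h + x * x - (h + y * y) = x * (x - y) + (x - y) * y.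
    by rewrite mulrBr mulrBl addrA subrK opprD addrACA subrr add0r.
  rewrite (le_trans (ler_normD _ _))// [leRHS]mulrDl lerD ?cstar_ler_normM//.
  by rewrite mulrC cstar_ler_normM.
have fq x y : U x -> U y -> `|f x - f y| <= r * `|x - y|.
  move=> [_ xr] [_ yr]; apply: le_trans (fdist x y) _.
  rewrite mulrA ler_wpM2r// ler_pdivrMl ?ltr0n//.
  by rewrite mulr_natl mulr2n lerD.
have U0 : U 0 by split; rewrite ?star0 ?normr0.
have Ur x : U x -> `|0 - x| <= r by move=> [_]; rewrite sub0r normrN.
have [l ly] := contraction_cvg_dist r0 r1 fU Ur fq U0.
have Uy n : U (iter n f 0) by elim: n => //= n; exact: fU.
(* Both equations that define l hold up to a multiple of r ^+ n for every n,
   by comparison with the n-th iterate. *)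
have sl : star l = l.
  apply/eqP; rewrite -subr_eq0 -normr_le0.
  apply: (@le_geometric_le0 _ (r + r) r) => // [|n]; first exact: addr_ge0.
  rewrite (le_trans (ler_distD (iter n f 0) _ _))// mulrDl lerD//; last first.
    by rewrite distrC.
  by have [sy _] := Uy n; rewrite -{1}sy -starB norm_star.
have lf : f l = l.
  apply/eqP; rewrite -subr_eq0 -normr_le0.
  set c := 2^-1 * (`|l| + r) * r.
  have c0 : 0 <= c by rewrite !mulr_ge0 ?invr_ge0// addr_ge0.
  apply: (@le_geometric_le0 _ (c + r * r) r) => // [|n].
    exact: addr_ge0 c0 (mulr_ge0 r0 r0).
  rewrite (le_trans (ler_distD (iter n.+1 f 0) _ _))// mulrDl lerD//.
    rewrite (le_trans (fdist _ _))// /c -!mulrA ler_wpM2l ?invr_ge0//.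
    apply: ler_pM (ly n) => //.
    by rewrite lerD//; case: (Uy n).
  by rewrite distrC -mulrA -exprS; exact: ly n.+1.
exists (1 - l); first by rewrite starB star1 sl.
have ll : l * l = l + l - h.
  have : (2 : R[i]) *: f l = h + l * l by rewrite /f scalerA divff ?scale1r.
  by rewrite lf scaler_nat mulr2n => ->; rewrite addrC addKr.
by rewrite mulrBl mul1r mulrBr mulr1 ll opprB
  (addrAC (l + l)) addrK addrA subrK.
Qed.

(** * Positive functionals and states *)

(** Positivity at 1 + t *: x makes t phi x + t^* phi (star x) real for every
    scalar t; the values t = 1 and t = 'i then force phi (star x) to be the
    conjugate of phi x. *)
Lemma positive_functional_star (R : realType) (A : cstarAlgType R)
    (phi : {scalar A}) (x : A) :
  positive_functional phi -> phi (star x) = (phi x)^*.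
Proof.
move=> phi_ge0.
have real_of (t : R[i]) : t * phi x + t^* * phi (star x) \is Num.real.
  have -> : t * phi x + t^* * phi (star x) =
      phi (star (1 + t *: x) * (1 + t *: x)) - phi (star 1 * 1)
      - t^* * t * phi (star x * x).
    rewrite starD starZ_conj star1 mulrDl !mulrDr !mul1r mulr1.
    by rewrite -scalerAl -scalerAr scalerA !(linearD phi) !(scalarZ phi) /=;
      ring.
  have tt : 0 <= t^* * t by rewrite mulrC -normCK exprn_ge0.
  rewrite !rpredB//; first exact: ger0_real (phi_ge0 _).
    exact: ger0_real (phi_ge0 _).
  exact: ger0_real (mulr_ge0 tt (phi_ge0 _)).
have := conj_Creal (real_of 1); have := conj_Creal (real_of 'i).
rewrite !rmorphD !rmorphM /= !conjCK !conjC1 !conjCi !mul1r.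
set u := phi x; set v := phi (star x) => Ei E1.
have {}Ei : v^* - u^* = u - v.
  apply: (mulfI (neq0Ci R[i])).
  by transitivity (- 'i * u^* + 'i * v^*); [ring | rewrite Ei; ring].
have E2 : (2 : R[i]) * v^* = 2 * u.
  by transitivity ((u^* + v^*) + (v^* - u^*)); [ring | rewrite Ei E1; ring].
by rewrite -(mulfI _ E2) ?conjCK// pnatr_eq0.
Qed.

Lemma positive_functional_CS (R : realType) (A : cstarAlgType R)
    (phi : {scalar A}) (x y : A) : positive_functional phi ->
  `|phi (star y * x)| <= sqrtC (phi (star x * x)) * sqrtC (phi (star y * y)).
Proof.
move=> phi_ge0.
rewrite -(ler_pXn2r (n := 2)) ?nnegrE ?mulr_ge0 ?sqrtC_ge0//.
rewrite exprMn !sqrtCK normCK; set c := phi (star y * x).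
have p0 := phi_ge0 x; have q0 := phi_ge0 y.
set p := phi (star x * x) in p0 *; set q := phi (star y * y) in q0 *.
have cE : phi (star x * y) = c^*.
  by rewrite -positive_functional_star// starM starK.
have quad (s t : R[i]) :
    0 <= s * s^* * p - s * t^* * c - s^* * t * c^* + t * t^* * q.
  have H := phi_ge0 (s *: x - t *: y); move: H.
  rewrite (_ : phi _ =
    s * s^* * p - s * t^* * c - s^* * t * c^* + t * t^* * q)//.
  rewrite starB !starZ_conj mulrBl !mulrBr.
  rewrite -![in LHS]scalerAl -![in LHS]scalerAr ![in LHS]scalerA.
  rewrite !(linearB phi) !(scalarZ phi) /= cE -/p -/q -/c.
  by ring.
have pC : p^* = p by rewrite conj_Creal// ger0_real.
have qC : q^* = q by rewrite conj_Creal// ger0_real.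
(* The usual choice of coefficients, s = q and t = c, bounds |c|^2 after
   division by q. When q = 0 the roles of x and y are exchanged, and when
   p = 0 as well the value of the form at s = 1, t = c is - 2 |c|^2. *)
have [q00|q00] := eqVneq q 0; last first.
  have := quad q c; rewrite qC.
  have -> : q * q * p - q * c^* * c - q * c * c^* + c * c^* * q =
    q * (p * q - c * c^*) by ring.
  by rewrite pmulr_rge0 ?subr_ge0// lt_def q00.
have [p00|p00] := eqVneq p 0; last first.
  have := quad c^* p; rewrite pC conjCK.
  have -> : c^* * c * p - c^* * p * c - c * p * c^* + p * p * q =
    p * (p * q - c * c^*) by ring.
  by rewrite pmulr_rge0 ?subr_ge0// lt_def p00.
have := quad 1 c; rewrite p00 q00 conjC1.
have -> : 1 * 1 * 0 - 1 * c^* * c - 1 * c * c^* + c * c^* * 0 =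
  - (2 * (c * c^*)) by ring.
by rewrite oppr_ge0 mul0r pmulr_rle0 ?ltr0n.
Qed.

(** For every e > 0 the element t = `|h| + e satisfies t - h = t s^2 with s
    self-adjoint, so phi h <= t. *)
Lemma state_le_norm (R : realType) (A : cstarAlgType R) (phi : {scalar A})
    (h : A) :
  state_space A phi -> star h = h -> phi h <= `|h|.
Proof.
move=> [phi_ge0 phi1] hh; apply/ler_addgt0Pr => e e0.
set t := `|h| + e.
have t0 : 0 < t by rewrite ltr_wpDl.
have [||s ss s2] := @sqrt_one_sub_exists R A (t^-1 *: h).
- by rewrite starZ_conj hh conj_Creal// ger0_real// invr_ge0 ltW.
- rewrite normrZ ger0_norm ?invr_ge0 ?ltW// ltr_pdivrMl// mulr1.
  by rewrite ltrDl.
have := phi_ge0 s; rewrite ss s2 (linearB phi) (scalarZ phi) /= phi1 subr_ge0.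
by rewrite ler_pdivrMl// mulr1.
Qed.

Lemma state_seminorm_le (R : realType) (A : cstarAlgType R) (phi : {scalar A})
    (x : A) :
  state_space A phi -> sqrtC (phi (star x * x)) <= `|x|.
Proof.
move=> sphi; have [phi_ge0 _] := sphi.
rewrite -(ler_pXn2r (n := 2)) ?nnegrE ?sqrtC_ge0//.
by rewrite sqrtCK -norm_starM state_le_norm// starM starK.
Qed.

Lemma norm_state_le_seminorm (R : realType) (A : cstarAlgType R)
    (phi : {scalar A}) (x : A) :
  state_space A phi -> `|phi x| <= sqrtC (phi (star x * x)).
Proof.
move=> [phi_ge0 phi1]; have := positive_functional_CS x 1 phi_ge0.
by rewrite star1 !mul1r phi1 sqrtC1 mulr1.
Qed.

Lemma norm_state_le (R : realType) (A : cstarAlgType R) (phi : {scalar A})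
    (x : A) : state_space A phi -> `|phi x| <= `|x|.
Proof.
move=> sphi; apply: le_trans (norm_state_le_seminorm x sphi) _.
exact: state_seminorm_le.
Qed.

(** * The Buzano inequality for states *)

Lemma max1_norm_ge0 (R : realType) (z : R[i]) : 0 <= Num.max 1 `|z|.
Proof. by rewrite comparable_le_max ?ler01// real_comparable. Qed.

(** For z = alpha <b, 1> 1 - b, the difference of alpha phi b phi a and
    phi (a * b) is phi (a * z) = <z, star a>, which Cauchy-Schwarz bounds. The
    seminorm of z is found from the decomposition of b along 1:
    phi (star z * z) = (|alpha - 1|^2 - 1) |phi b|^2 + phi (star b * b), where
    |phi b|^2 <= phi (star b * b). *)
Lemma state_buzano (R : realType) (A : cstarAlgType R) (phi : {scalar A})
    (a b : A) (alpha : R[i]) :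
  state_space A phi ->
  `|alpha| * `|phi b * phi a| <=
    Num.max 1 `|alpha - 1|
      * (sqrtC (phi (star b * b)) * sqrtC (phi (a * star a)))
    + `|phi (a * b)|.
Proof.
move=> sphi; have [phi_ge0 phi1] := sphi; set M := Num.max _ _.
have cmp : (1 >=< `|alpha - 1|)%O by rewrite real_comparable.
have M1 : 1 <= M by rewrite comparable_le_max// lexx.
have Ma : `|alpha - 1| <= M by rewrite comparable_le_max// lexx orbT.
have M0 : 0 <= M := max1_norm_ge0 _.
set z := (alpha * phi b) *: 1 - b.
have az : phi (a * z) = alpha * (phi b * phi a) - phi (a * b).
  by rewrite mulrBr -scalerAr mulr1 (linearB phi) (scalarZ phi) /= mulrA.
have zz : sqrtC (phi (star z * z)) <= M * sqrtC (phi (star b * b)).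
  rewrite -(ler_pXn2r (n := 2)) ?nnegrE ?mulr_ge0 ?sqrtC_ge0//.
  rewrite exprMn !sqrtCK.
  have bb : `|phi b| ^+ 2 <= phi (star b * b).
    by rewrite -[leRHS]sqrtCK ler_pXn2r ?nnegrE ?sqrtC_ge0//
      norm_state_le_seminorm.
  have -> : phi (star z * z) =
      (`|alpha - 1| ^+ 2 - 1) * `|phi b| ^+ 2 + phi (star b * b).
    rewrite starB starZ_conj star1 mulrBl !mulrBr -!scalerAl -!scalerAr.
    rewrite scalerA !mul1r !mulr1 !(linearB phi) !(scalarZ phi) /= phi1.
    rewrite positive_functional_star// !normCK rmorphB !rmorphM /= conjC1.
    by ring.
  rewrite -lerBrDr -[X in _ <= _ - X]mul1r -mulrBl.
  have M2 : 0 <= M ^+ 2 - 1 by rewrite subr_ge0 exprn_ege1.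
  rewrite (le_trans _ (ler_wpM2l M2 bb))// ler_wpM2r ?exprn_ge0//.
  by rewrite lerD2r ler_pXn2r ?nnegrE.
rewrite -normrM -[alpha * _](subrK (phi (a * b))) -az.
rewrite (le_trans (ler_normD _ _))// lerD2r.
have := positive_functional_CS z (star a) phi_ge0.
rewrite starK => /le_trans; apply.
rewrite mulrA ler_wpM2r// sqrtC_ge0.
by have := phi_ge0 (star a); rewrite starK.
Qed.

Lemma state_seminorm_AGM (R : realType) (A : cstarAlgType R)
    (phi : {scalar A}) (a : A) : state_space A phi ->
  sqrtC (phi (star a * a)) * sqrtC (phi (a * star a))
    <= `|a * star a + star a * a| / 2.
Proof.
move=> sphi; have [phi_ge0 _] := sphi.
have p0 := phi_ge0 a; have := phi_ge0 (star a); rewrite starK => q0.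
rewrite (@le_trans _ _ ((phi (star a * a) + phi (a * star a)) / 2))//.
  rewrite -[X in (X + _) / 2]sqrtCK -[X in (_ + X) / 2]sqrtCK.
  rewrite ler_pdivlMr// -subr_ge0.
  set s := sqrtC _; set t := sqrtC _.
  have -> : s ^+ 2 + t ^+ 2 - s * t * 2 = (s - t) ^+ 2 by ring.
  by rewrite real_exprn_even_ge0// realB ?ger0_real// sqrtC_ge0.
rewrite ler_pM2r ?invr_gt0// addrC -(linearD phi).
by rewrite state_le_norm// starD !starM starK.
Qed.

(** * The bound for a single state *)

Lemma state_cube_le (R : realType) (A : cstarAlgType R) (phi : {scalar A})
    (a : A) (alpha beta : R[i]) :
  alpha != 0 -> beta != 0 -> state_space A phi ->
  `|phi a| ^+ 3 <=
    Num.max 1 `|alpha - 1| / (2 * `|alpha|)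
      * `|a * star a + star a * a| * `|a|
    + Num.max 1 `|beta - 1| / `|alpha * beta| * `|a ^+ 2| * `|a|
    + 1 / `|alpha * beta| * `|phi (a ^+ 3)|.
Proof.
rewrite -(normr_gt0 alpha) -(normr_gt0 beta) => al0 be0 sphi.
have H1 := state_buzano a a alpha sphi.
have H2 := state_buzano a (a ^+ 2) beta sphi.
have {}H1 : `|alpha| * `|phi a| ^+ 2 <= Num.max 1 `|alpha - 1| *
    (`|a * star a + star a * a| / 2) + `|phi (a ^+ 2)|.
  rewrite normrM -!expr2 in H1; apply: le_trans H1 _.
  by rewrite lerD2r ler_wpM2l ?max1_norm_ge0// state_seminorm_AGM.
have {}H2 : `|beta| * (`|phi (a ^+ 2)| * `|phi a|) <=
    Num.max 1 `|beta - 1| * (`|a ^+ 2| * `|a|) + `|phi (a ^+ 3)|.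
  rewrite normrM -exprS in H2; apply: le_trans H2 _.
  rewrite lerD2r ler_wpM2l ?max1_norm_ge0//.
  have [phi_ge0 _] := sphi.
  have := state_seminorm_le (star a) sphi.
  have := phi_ge0 (star a); rewrite starK norm_star => q0 qa.
  by rewrite ler_pM ?sqrtC_ge0 ?state_seminorm_le//; exact: phi_ge0.
rewrite normrM.
set Ma := Num.max _ _ in H1 *; set Mb := Num.max _ _ in H2 *.
have Ma0 : 0 <= Ma by exact: max1_norm_ge0.
have xn := norm_state_le a sphi.
move: al0 be0 H1 H2 xn; set s := `|alpha|; set t := `|beta|.
set x := `|phi a|; set n := `|a|; set w := `|phi (a ^+ 2)|.
set y := `|phi (a ^+ 3)|; set N := `|a * star a + _|; set P := `|a ^+ 2|.
have [x0 N0] : 0 <= x /\ 0 <= N by split; exact: normr_ge0.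
move=> s0 t0 H1 H2 xn.
have -> : Ma / (2 * s) * N * n + Mb / (s * t) * P * n + 1 / (s * t) * y =
    (t * (Ma * (N / 2)) * n + (Mb * (P * n) + y)) / (s * t).
  by field; rewrite !gt_eqF.
rewrite ler_pdivlMr ?mulr_gt0//.
have -> : x ^+ 3 * (s * t) = t * (s * x ^+ 2) * x by ring.
(* The first use of the Buzano inequality enters here, multiplied by t x; the
   term t w x that it leaves is what the second one bounds. *)
apply: (@le_trans _ _ (t * (Ma * (N / 2) + w) * x)).
  by rewrite ler_wpM2r// ler_wpM2l// ltW.
rewrite mulrDr mulrDl -(mulrA t w) lerD// ler_wpM2l// mulr_ge0 ?(ltW t0)//.
by rewrite mulr_ge0// divr_ge0.
Qed.

(** * The numerical radius *)

Lemma numerical_radius_ge0 (R : realType) (A : cstarAlgType R) (a : A) :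
  0 <= numerical_radius a.
Proof.
rewrite ler0c; set S := [set _ | _ in _]%classic.
have [supS|/sup_out ->//] := pselect (has_sup S).
have [x Sx] := supS.1; apply: le_trans (sup_upper_bound supS Sx).
by have [phi _ <-] := Sx; rewrite -ler0c; exact: (normr_ge0 (phi a)).
Qed.

Lemma numerical_radius_le (R : realType) (A : cstarAlgType R) (a : A)
    (c : R[i]) :
  0 <= c -> (forall phi, state_space A phi -> `|phi a| <= c) ->
  numerical_radius a <= c.
Proof.
move=> c0 le_c; have cE : c = (complex.Re c)%:C%C.
  by rewrite RRe_real// ger0_real.
rewrite cE lecR; set S := [set _ | _ in _]%classic.
(* The supremum of the empty set is 0 by convention, and c is nonnegative. *)
have [->|S0] := eqVneq S set0; first by rewrite sup0 -ler0c -cE.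
apply: ge_sup; first exact/set0P.
by move=> _ [phi sphi <-]; rewrite -lecR -cE; exact: le_c.
Qed.

Lemma le_numerical_radius (R : realType) (A : cstarAlgType R) (a : A)
    (phi : {scalar A}) :
  state_space A phi -> `|phi a| <= numerical_radius a.
Proof.
move=> sphi; rewrite lecR; apply: ub_le_sup; last by exists phi.
exists (complex.Re `|a|) => _ [psi spsi <-].
rewrite -lecR RRe_real ?normr_real//; exact: norm_state_le.
Qed.

Theorem theorem2p10 (R : realType) (A : cstarAlgType R) (a : A)
    (alpha beta : R[i]) (alpha_neq0 : alpha != 0) (beta_neq0 : beta != 0) :
  numerical_radius a ^+ 3 <=
    Num.max 1 `|alpha - 1| / (2 * `|alpha|)
      * `|a * star a + star a * a| * `|a|
    + Num.max 1 `|beta - 1| / `|alpha * beta| * `|a ^+ 2| * `|a|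
    + 1 / `|alpha * beta| * numerical_radius (a ^+ 3).
Proof.
set Q := leRHS.
have Q0 : 0 <= Q.
  by rewrite !addr_ge0// ?mulr_ge0 ?invr_ge0 ?mulr_ge0 ?max1_norm_ge0
    ?numerical_radius_ge0.
(* The supremum is taken of |phi a| and not of its cube, so each state is
   compared with the cube root of the bound. *)
rewrite -[leRHS](rootCK (n := 3))// ler_pXn2r ?nnegrE ?rootC_ge0
  ?numerical_radius_ge0//.
apply: numerical_radius_le; first by rewrite rootC_ge0.
move=> phi sphi.
rewrite -(ler_pXn2r (n := 3)) ?nnegrE ?rootC_ge0// rootCK//.
apply: le_trans (state_cube_le a alpha_neq0 beta_neq0 sphi) _.
by rewrite lerD2l ler_wpM2l ?divr_ge0// le_numerical_radius.
Qed.
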